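(* Writing $N_{ij}(\theta):=N_{\Lambda_i,\Lambda_j}(\theta)$ for $i,j\in\{1,2\}$, each element of $A_0(\theta)=-N_{11}^{-1}(\theta)\,N_{12}(\theta)$ and of $\widetilde N(\theta)$ is, as a function of $\theta$, a linear combination (with constant real coefficients) of $1,\ \sin\theta,\ \cos\theta,\ \sin2\theta,\ \cos2\theta$.
   Context: Let $n\ge1$ be an integer. For $1\le i<j\le n$ let $\ell_{ij}=\ell_{ji}\in(0,+\infty]$, with $\ell_{ij}^{-1}=0$ when $\ell_{ij}=+\infty$. Standing assumption: the graph on $\{1,\dots,n\}$ with an edge between $i\ne j$ exactly when $\ell_{ij}<+\infty$ is connected. Let $r_1\in(0,+\infty)$ and $r_i\in(0,+\infty]$ for $2\le i\le n$. Coordinates of $\mathbb{R}^{2n+4}$ are ordered $1\alpha,1\beta,\dots,n\alpha,n\beta,f,D,g,Q$ and numbered $1,\dots,2n+4$, so node $i$ corresponds to coordinates $2i-1,2i$. Let $L\in\mathbb{R}^{2n\times2n}$ have, for $1\le i,j\le n$, entries $L_{i\alpha,j\beta}=L_{i\beta,j\alpha}=0$ and $L_{i\alpha,j\alpha}=L_{i\beta,j\beta}$ equal to $\sum_{k\ne i}\ell_{ik}^{-1}$ if $i=j$ and to $-\ell_{ij}^{-1}$ if $i\ne j$. Let $$K_L=\begin{pmatrix}L&0\\0&0\end{pmatrix}\in\mathbb{R}^{(2n+4)\times(2n+4)},\qquad \Gamma(\theta)=\begin{pmatrix}0&0\\0&P(\theta)\Gamma_0P(-\theta)\end{pmatrix}\in\mathbb{R}^{(2n+4)\times(2n+4)},$$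 $$P(\theta)=\begin{pmatrix}\cos\theta&-\sin\theta&0\\ \sin\theta&\cos\theta&0\\0&0&I_4\end{pmatrix}\in\mathbb{R}^{6\times 6},$$ where $\Gamma_0\in\mathbb{R}^{6\times6}$ is a constant (symmetric) positive definite matrix, and put $N(\theta):=K_L+\Gamma(\theta)$ for $\theta\in\mathbb{R}$ (which is positive definite for every $\theta$). Let $$\Lambda_1:=\{2i-1,2i:\ r_i=+\infty,\ 1\le i\le n\},\qquad \Lambda_2:=\{1,\dots,2n+4\}\setminus\Lambda_1,$$ and for $i,j\in\{1,2\}$ let $N_{\Lambda_i,\Lambda_j}(\theta)$ be the submatrix of $N(\theta)$ with rows in $\Lambda_i$ and columns in $\Lambda_j$. After re-numbering, coordinates in $\Lambda_1$ are listed before those in $\Lambda_2$. Define $$A(\theta)=\begin{pmatrix}A_0(\theta)\\ I_{|\Lambda_2|}\end{pmatrix},\qquad A_0(\theta)=-N_{\Lambda_1,\Lambda_1}^{-1}(\theta)N_{\Lambda_1,\Lambda_2}(\theta),\qquad \widetilde N(\theta):=A^\top(\theta)N(\theta)A(\theta)$$ (if $\Lambda_1=\emptyset$, then $A(\theta)=I$ and $\widetilde N(\theta)=N(\theta)$). *)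

(* Defs.v *)
From HB Require Import structures.
From mathcomp Require Import all_boot all_order all_algebra.
From mathcomp Require Import reals constructive_ereal trigo.

Set Implicit Arguments.
Unset Strict Implicit.
Unset Printing Implicit Defensive.

Import Order.TTheory GRing.Theory Num.Theory.

Local Open Scope ring_scope.

(* Nodes are 0-based, so node 1 is ord0; coordinates of
   R^(2n+4) are likewise 0-based, so node k owns coordinates 2k (alpha) and
   2k+1 (beta), and the last four coordinates are f, D, g, Q. *)

Lemma half_lt_dbl (n : nat) (p : 'I_(2 * n)) : (p./2 < n)%N.
Proof. by rewrite ltn_half_double -mul2n. Qed.

Definition node (n : nat) (p : 'I_(2 * n)) : 'I_n := Ordinal (half_lt_dbl p).

(* The extended-real inverse satisfies (+oo)^-1 = 0. *)
Definition admittance (R : realType) (n : nat) (l : 'I_n -> 'I_n -> \bar R)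
    (i j : 'I_n) : R :=
  fine (l i j)^-1%E.

Definition line_rel (R : realType) (n : nat) (l : 'I_n -> 'I_n -> \bar R) :
    rel 'I_n :=
  fun i j => (i != j) && (l i j < +oo)%E.

Definition line_connected (R : realType) (n : nat)
    (l : 'I_n -> 'I_n -> \bar R) : Prop :=
  forall i j : 'I_n, connect (line_rel l) i j.

Definition laplacian (R : realType) (n : nat) (l : 'I_n -> 'I_n -> \bar R) :
    'M[R]_n :=
  \matrix_(i, j) if i == j then \sum_(k | k != i) admittance l i k
                 else - admittance l i j.

(* The parity of a coordinate tells the alpha phase from the beta phase. *)
Definition Lmx (R : realType) (n : nat) (l : 'I_n -> 'I_n -> \bar R) :
    'M[R]_(2 * n) :=
  \matrix_(p, q) if odd p == odd q then laplacian l (node p) (node q) else 0.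

Definition KL (R : realType) (n : nat) (l : 'I_n -> 'I_n -> \bar R) :
    'M[R]_(2 * n + 4) :=
  block_mx (Lmx l) 0 0 0.

Definition rot2 (R : realType) (t : R) : 'M[R]_2 :=
  block_mx (cos t)%:M (- sin t)%:M
           (sin t)%:M (cos t)%:M :> 'M[R]_(1 + 1).

Definition Pmx (R : realType) (t : R) : 'M[R]_6 :=
  block_mx (rot2 t) 0 0 1%:M :> 'M[R]_(2 + 4).

Definition posdefmx (R : realType) (n : nat) (M : 'M[R]_n) : Prop :=
  M^T = M /\ forall v : 'cV[R]_n, v != 0 -> 0 < (v^T *m M *m v) 0 0.

Lemma coord_dimE (m : nat) : (2 * m + 6 = 2 * m.+1 + 4)%N.
Proof. by rewrite mulnS addnAC addnC. Qed.

(* The 6 x 6 block occupies the coordinates of the last node and f, D, g, Q;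
   this makes sense for n = m.+1 >= 1 nodes only. *)
Definition Gammamx (R : realType) (m : nat) (G0 : 'M[R]_6) (t : R) :
    'M[R]_(2 * m.+1 + 4) :=
  castmx (coord_dimE m, coord_dimE m)
    (block_mx 0 0 0 (Pmx t *m G0 *m Pmx (- t)) : 'M[R]_(2 * m + 6)).

Definition Nmx (R : realType) (m : nat) (l : 'I_m.+1 -> 'I_m.+1 -> \bar R)
    (G0 : 'M[R]_6) (t : R) : 'M[R]_(2 * m.+1 + 4) :=
  KL l + Gammamx m G0 t.

Definition Lambda1 (R : realType) (n : nat) (r : 'I_n -> \bar R) :
    {set 'I_(2 * n + 4)} :=
  [set p | if split p is inl k then r (node k) == +oo%E else false].

Definition Lambda2 (R : realType) (n : nat) (r : 'I_n -> \bar R) :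
    {set 'I_(2 * n + 4)} :=
  ~: Lambda1 r.

(* Rows and columns keep the increasing order of the indices in S and T. *)
Definition submx_of (R : realType) (d : nat) (S T : {set 'I_d})
    (M : 'M[R]_d) : 'M[R]_(#|S|, #|T|) :=
  mxsub (fun i : 'I_#|S| => enum_val i) (fun j : 'I_#|T| => enum_val j) M.

(* M with the coordinates in S listed before those in T. *)
Definition renumber (R : realType) (d : nat) (S T : {set 'I_d})
    (M : 'M[R]_d) : 'M[R]_(#|S| + #|T|) :=
  block_mx (submx_of S S M) (submx_of S T M)
           (submx_of T S M) (submx_of T T M).

Definition A0mx (R : realType) (m : nat) (l : 'I_m.+1 -> 'I_m.+1 -> \bar R)
    (r : 'I_m.+1 -> \bar R) (G0 : 'M[R]_6) (t : R) :
    'M[R]_(#|Lambda1 r|, #|Lambda2 r|) :=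
  - invmx (submx_of (Lambda1 r) (Lambda1 r) (Nmx l G0 t))
    *m submx_of (Lambda1 r) (Lambda2 r) (Nmx l G0 t).

Definition Amx (R : realType) (m : nat) (l : 'I_m.+1 -> 'I_m.+1 -> \bar R)
    (r : 'I_m.+1 -> \bar R) (G0 : 'M[R]_6) (t : R) :
    'M[R]_(#|Lambda1 r| + #|Lambda2 r|, #|Lambda2 r|) :=
  col_mx (A0mx l r G0 t) 1%:M.

Definition Ntilde (R : realType) (m : nat) (l : 'I_m.+1 -> 'I_m.+1 -> \bar R)
    (r : 'I_m.+1 -> \bar R) (G0 : 'M[R]_6) (t : R) : 'M[R]_#|Lambda2 r| :=
  (Amx l r G0 t)^T *m renumber (Lambda1 r) (Lambda2 r) (Nmx l G0 t)
    *m Amx l r G0 t.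

Definition trig_lincomb (R : realType) (f : R -> R) : Prop :=
  exists c0 c1 c2 c3 c4 : R, forall t : R,
    f t = c0 * 1 + c1 * sin t + c2 * cos t
        + c3 * sin (2 * t) + c4 * cos (2 * t).

(* Main.v *)
Require Import Defs.
From HB Require Import structures.
From mathcomp Require Import all_boot all_order all_algebra.
From mathcomp Require Import reals constructive_ereal trigo.
From mathcomp Require Import zify ring.

Set Implicit Arguments.
Unset Strict Implicit.
Unset Printing Implicit Defensive.

Import Order.TTheory GRing.Theory Num.Theory.

Local Open Scope ring_scope.

(** The whole dependence on [t] is a change of basis.  Let [U t] be the matrix
that rotates the (alpha, beta) pair of every node by the angle [t] and fixes
f, D, g, Q ([rotmx m.+1 (2 * m.+1 + 4) t] below).  It is orthogonal, and
<<
  N(t) = U(t) N(0) U(t)^T          ([Nmx_conj])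
>>
for two reasons.  On the coordinates of the last node and f, D, g, Q the matrix
[U t] is [Pmx t], so conjugation by it produces the rotation built into Gamma
([Gammamx_conj]).  And [L] treats both phases alike without mixing them, hence
commutes with rotating all the nodes simultaneously ([KL_conj]); this is why all
nodes are rotated, although Gamma only sees the last one.

Both coordinates of a node lie in Lambda1 or both lie in Lambda2, so [U t] is
block diagonal for this partition, with orthogonal blocks [X1] and [X2].
Therefore each block of N is conjugated separately, and the orthogonal factors
in the middle of the Schur-type expressions cancel:
<<
  A0(t) = X1(t) A0(0) X2(t)^T,    Ntilde(t) = X2(t) Ntilde(0) X2(t)^T
>>
([A0mx_conj], [Ntilde_conj]).  The entries of [X1] and [X2] are affine in sin t
and cos t, so every entry on the right is a polynomial of degree at most 2 in
sin t and cos t, which the double angle formulas turn into a combination of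
1, sin t, cos t, sin 2t and cos 2t ([trig_lincomb_conj]). *)

(** * Trigonometric polynomials of degree one and two *)

Definition trig_affine (R : realType) (f : R -> R) : Prop :=
  exists a b c : R, forall t : R, f t = a + b * sin t + c * cos t.

Lemma trig_lincomb_sum (R : realType) (I : Type) (s : seq I)
    (f : I -> R -> R) :
  (forall i, trig_lincomb (f i)) ->
  trig_lincomb (fun t => \sum_(i <- s) f i t).
Proof.
move=> Hf; elim: s => [|i s [a0 [a1 [a2 [a3 [a4 IH]]]]]].
  by exists 0, 0, 0, 0, 0 => t; rewrite big_nil; ring.
have [b0 [b1 [b2 [b3 [b4 Hi]]]]] := Hf i.
exists (b0 + a0), (b1 + a1), (b2 + a2), (b3 + a3), (b4 + a4) => t.
by rewrite big_cons IH Hi; ring.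
Qed.

Lemma trig_lincombM (R : realType) (a : R) (f g : R -> R) :
  trig_affine f -> trig_affine g -> trig_lincomb (fun t => f t * a * g t).
Proof.
move=> [f0 [f1 [f2 Hf]]] [g0 [g1 [g2 Hg]]].
exists (a * (f0 * g0 + (f1 * g1 + f2 * g2) / 2)),
  (a * (f0 * g1 + f1 * g0)), (a * (f0 * g2 + f2 * g0)),
  (a * (f1 * g2 + f2 * g1) / 2), (a * (f2 * g2 - f1 * g1) / 2) => t.
rewrite Hf Hg mulr_natl sin_mulr2n cos_mulr2n.
have -> : cos t ^+ 2 *+ 2 - 1 = cos t ^+ 2 - sin t ^+ 2 :> R.
  by rewrite -{1}(cos2Dsin2 t); ring.
have E := cos2Dsin2 t.
(* The constant coefficient comes from the mean value 1/2 of sin^2 and cos^2;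
   the 1 next to it is written as cos^2 + sin^2 to make the identity
   polynomial. *)
rewrite -[X in _ = a * (f0 * g0 + X / 2) * 1 + _ + _ + _ + _]mulr1 -{1}E.
by field.
Qed.

Lemma trig_lincomb_conj (R : realType) (p q : nat) (X : R -> 'M[R]_p)
    (Y : R -> 'M[R]_q) (M : 'M[R]_(p, q)) (F : R -> 'M[R]_(p, q)) :
  (forall i j, trig_affine (fun t => X t i j)) ->
  (forall i j, trig_affine (fun t => Y t i j)) ->
  (forall t, F t = X t *m M *m (Y t)^T) ->
  forall i j, trig_lincomb (fun t => F t i j).
Proof.
move=> HX HY HF i j.
have: trig_lincomb (fun t => \sum_k \sum_h X t i h * M h k * Y t j k).
  apply: trig_lincomb_sum => k; apply: trig_lincomb_sum => h.
  exact: trig_lincombM.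
move=> [c0 [c1 [c2 [c3 [c4 H]]]]]; exists c0, c1, c2, c3, c4 => t.
rewrite -H HF mxE; apply: eq_bigr => k _.
by rewrite !mxE mulr_suml.
Qed.

(** * Conjugation by orthogonal matrices and its restriction to blocks *)

Lemma invmx_conj (R : comUnitRingType) (n : nat) (X M : 'M[R]_n) :
  X *m X^T = 1%:M -> invmx (X *m M *m X^T) = X *m invmx M *m X^T.
Proof.
move=> XXt; have XtX := mulmx1C XXt.
have [uX uXt] := mulmx1_unit XXt.
have uC : (X *m M *m X^T \in unitmx) = (M \in unitmx).
  by rewrite !unitmx_mul uX uXt andbT.
(* On singular matrices [invmx] is the identity, and conjugation preserves
   singularity. *)
have [uM | nuM] := boolP (M \in unitmx); last first.
  by rewrite !invmx_out ?inE ?uC.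
have E : (X *m M *m X^T) *m (X *m invmx M *m X^T) = 1%:M.
  rewrite -!mulmxA (mulmxA X^T X) XtX mul1mx (mulmxA M) mulmxV //.
  by rewrite mul1mx.
by rewrite -[RHS](@mulKmx _ _ _ (X *m M *m X^T)) ?uC // E mulmx1.
Qed.

(** The summation over the middle index can be cut down to [U], since the rows
of [A] in [S] vanish outside [U]. *)
Lemma submx_of_mul (R : realType) (d : nat) (S T U : {set 'I_d})
    (A B : 'M[R]_d) :
  (forall p q, p \in S -> q \notin U -> A p q = 0) ->
  submx_of S T (A *m B) = submx_of S U A *m submx_of U T B.
Proof.
move=> A0; apply/matrixP=> i j; rewrite !mxE.
rewrite (bigID (mem U)) /= [X in _ + X]big1 ?addr0; last first.
  by move=> k kU; rewrite A0 ?mul0r // enum_valP.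
by rewrite big_enum_val; apply: eq_bigr => k _; rewrite !mxE.
Qed.

Lemma tr_submx_of (R : realType) (d : nat) (S T : {set 'I_d}) (A : 'M[R]_d) :
  submx_of S T A^T = (submx_of T S A)^T.
Proof. by apply/matrixP=> i j; rewrite !mxE. Qed.

Lemma submx_of_conj (R : realType) (d : nat) (S T V W : {set 'I_d})
    (U M : 'M[R]_d) :
  (forall p q, p \in S -> q \notin V -> U p q = 0) ->
  (forall p q, p \in T -> q \notin W -> U p q = 0) ->
  submx_of S T (U *m M *m U^T) =
  submx_of S V U *m submx_of V W M *m (submx_of T W U)^T.
Proof.
move=> US UT; rewrite -mulmxA (@submx_of_mul _ _ S T V) //.
rewrite -[M *m _]trmxK tr_submx_of trmx_mul trmxK.
rewrite (@submx_of_mul _ _ T V W) // tr_submx_of trmx_mul trmxK.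
by rewrite mulmxA.
Qed.

Lemma submx_of_orth (R : realType) (d : nat) (S : {set 'I_d}) (U : 'M[R]_d) :
  (forall p q, p \in S -> q \notin S -> U p q = 0) ->
  U *m U^T = 1%:M -> submx_of S S U *m (submx_of S S U)^T = 1%:M.
Proof.
move=> US UU; rewrite -tr_submx_of -submx_of_mul // UU.
by apply/matrixP=> i j; rewrite !mxE (inj_eq enum_val_inj).
Qed.

(** * Simultaneous rotation of the nodes *)

(** Entry [(p, q)] of the rotation by [t] of the pairs (2i, 2i+1), i < k, all
other coordinates being fixed.  The indices are natural numbers so that the
same formula describes the rotation in every ambient dimension, which lets
[rotmx] below be compared across block decompositions and [castmx]. *)
Definition rot_entry (R : realType) (k : nat) (t : R) (p q : nat) : R :=
  if p./2 != q./2 then 0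
  else if (p./2 < k)%N then
    if odd p == odd q then cos t else if odd p then sin t else - sin t
  else (odd p == odd q)%:R.

Definition rotmx (R : realType) (k d : nat) (t : R) : 'M[R]_d :=
  \matrix_(p, q) rot_entry k t p q.

Lemma half_odd_inj (p q : nat) : p./2 = q./2 -> odd p = odd q -> p = q.
Proof. by lia. Qed.

Lemma rotmx0k (R : realType) (d : nat) (t : R) : rotmx 0 d t = 1%:M.
Proof.
apply/matrixP=> p q; rewrite !mxE /rot_entry.
have -> : (p == q) = (p./2 == q./2) && (odd p == odd q).
  by apply/eqP/andP => [->//|[/eqP hE /eqP oE]]; apply/val_inj/half_odd_inj.
by case: eqP.
Qed.

Lemma rotmx_at0 (R : realType) (k d : nat) : rotmx k d (0 : R) = 1%:M.
Proof.
rewrite -(@rotmx0k R d 0); apply/matrixP=> p q.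
rewrite !mxE /rot_entry cos0 sin0 oppr0 if_same; case: ifP => // _.
by case: ifP => // _; case: eqP.
Qed.

Lemma tr_rotmx (R : realType) (k d : nat) (t : R) :
  (rotmx k d t)^T = rotmx k d (- t).
Proof.
apply/matrixP=> p q; rewrite !mxE /rot_entry cosN sinN opprK eq_sym.
case: eqP => //= ->; rewrite [in odd q == _]eq_sym.
by case: (odd p); case: (odd q).
Qed.

(** The first block has the even size [2 * k], so shifting an index by it
preserves parity and moves the node number by [k]: rotations of consecutive
groups of nodes fit together into one rotation. *)
Lemma rotmx_block (R : realType) (k j e : nat) (t : R) :
  block_mx (rotmx k (2 * k) t) 0 0 (rotmx j e t) = rotmx (k + j) (2 * k + e) t.
Proof.
have lt_half (i : 'I_(2 * k)) : (i./2 < k)%N by case: i => i /=; lia.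
have half_k (i : nat) : (2 * k + i)./2 = (k + i./2)%N by lia.
have odd_k (i : nat) : odd (2 * k + i) = odd i by lia.
apply/matrixP=> p q; rewrite !mxE.
case: split_ordP => p' ->; rewrite !mxE; case: split_ordP => q' ->;
  rewrite !mxE /rot_entry /= ?half_k ?odd_k.
- by rewrite lt_half ltn_addr.
- have := lt_half p'; case: eqP => //=; lia.
- have := lt_half q'; case: eqP => //=; lia.
- by rewrite eqn_add2l ltn_add2l.
Qed.

Lemma Pmx_rotmx (R : realType) (t : R) : Pmx t = rotmx 1 6 t.
Proof.
suff E : rot2 t = rotmx 1 2 t.
  by rewrite /Pmx E -(rotmx0k 4 t); exact: (rotmx_block 1 0 4 t).
apply/matrixP=> p q; rewrite /rot2 !mxE.
case: split_ordP => p' ->; rewrite !mxE; case: split_ordP => q' ->;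
  by rewrite !mxE !ord1.
Qed.

(** * Orthogonality, and commutation with the network Laplacian *)

Lemma mate_subproof (k : nat) (p : 'I_(2 * k)) :
  ((if odd p then p.-1 else p.+1) < 2 * k)%N.
Proof. case: p => p /=; case: ifP; lia. Qed.

(** The other phase of the same node: row [p] of the rotation is supported on
[p] and [mate p]. *)
Definition mate (k : nat) (p : 'I_(2 * k)) := Ordinal (mate_subproof p).

Lemma odd_mate (k : nat) (p : 'I_(2 * k)) : odd (mate p) = ~~ odd p.
Proof. case: p => p /=; case: ifP; lia. Qed.

Lemma node_mate (k : nat) (p : 'I_(2 * k)) : node (mate p) = node p.
Proof. apply: val_inj; case: p => p /=; case: ifP; lia. Qed.

Lemma rotmx_sum (R : realType) (k : nat) (t : R) (p : 'I_(2 * k))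
    (F : 'I_(2 * k) -> R) :
  \sum_s rotmx k (2 * k) t p s * F s =
  cos t * F p + (-1) ^+ (~~ odd p) * sin t * F (mate p).
Proof.
have pk : (p./2 < k)%N := half_lt_dbl p.
have mE : (mate p)./2 = p./2 := congr1 val (node_mate p).
have mp : mate p != p.
  by apply/eqP => /(congr1 (odd \o val)) /=; rewrite odd_mate; case: odd.
rewrite (bigD1 p) //= (bigD1 (mate p)) //= big1 ?addr0 => [|s /andP[sp sm]].
  rewrite !mxE /rot_entry eqxx mE eqxx pk eqxx odd_mate.
  by case: (odd p); rewrite /= ?expr0 ?expr1 ?mul1r ?mulN1r.
rewrite mxE /rot_entry; case: eqP => [hE|]; last by rewrite mul0r.
case: (boolP (odd p == odd s)) => [/eqP oE|oE].
  by case/eqP: sp; apply/val_inj/esym/half_odd_inj.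
case/eqP: sm; apply/val_inj/half_odd_inj; first by rewrite mE.
by rewrite odd_mate; case: (odd p) (odd s) oE => [] [].
Qed.

Lemma rotmx_orth_even (R : realType) (k : nat) (t : R) :
  rotmx k (2 * k) t *m (rotmx k (2 * k) t)^T = 1%:M.
Proof.
apply/matrixP=> p q; rewrite mxE rotmx_sum.
rewrite -(rotmx0k _ t) !mxE /rot_entry.
have mE : (mate p)./2 = p./2 := congr1 val (node_mate p).
rewrite mE odd_mate [(q./2 < k)%N](half_lt_dbl q) /= eq_sym.
case: eqP => //= _; last by rewrite !mulr0 addr0.
have E := cos2Dsin2 t.
by case: (odd p); case: (odd q); rewrite /= ?expr0 ?expr1;
  first [ring | rewrite -[RHS]E; ring].
Qed.

(** [L] is the Laplacian acting identically on both phases, so it commutes with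
anything that acts in the same way on the phase plane of every node. *)
Lemma rotmx_Lmx (R : realType) (n : nat) (l : 'I_n -> 'I_n -> \bar R) (t : R) :
  rotmx n (2 * n) t *m Lmx l *m (rotmx n (2 * n) t)^T = Lmx l.
Proof.
suff -> : rotmx n (2 * n) t *m Lmx l = Lmx l *m rotmx n (2 * n) t.
  by rewrite -mulmxA rotmx_orth_even mulmx1.
apply/matrixP=> p q; rewrite mxE rotmx_sum.
(* Column [q] of a rotation is row [q] of the inverse rotation, so the row
   formula [rotmx_sum] also evaluates products with the rotation on the
   right. *)
have -> : (Lmx l *m rotmx n (2 * n) t) p q =
    \sum_s rotmx n (2 * n) (- t) q s * Lmx l p s.
  by rewrite mxE; apply: eq_bigr => s _; rewrite -tr_rotmx [_^T _ _]mxE mulrC.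
rewrite rotmx_sum !mxE cosN sinN !odd_mate !node_mate.
by case: (odd p); case: (odd q); rewrite /= ?expr0 ?expr1; ring.
Qed.

Lemma castmx_conj (R : realType) (a b : nat) (e : a = b) (U M : 'M[R]_a) :
  castmx (e, e) U *m castmx (e, e) M *m (castmx (e, e) U)^T =
  castmx (e, e) (U *m M *m U^T).
Proof. by case: b / e; rewrite !castmx_id. Qed.

Lemma castmx_rotmx (R : realType) (k a b : nat) (e : a = b) (t : R) :
  castmx (e, e) (rotmx k a t) = rotmx k b t.
Proof. by case: b / e; rewrite !castmx_id. Qed.

(** * The matrix N(t) is a rotated copy of N(0) *)

Lemma rotmx_block0 (R : realType) (n e : nat) (t : R) :
  rotmx n (2 * n + e) t = block_mx (rotmx n (2 * n) t) 0 0 1%:M.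
Proof. by rewrite -(rotmx0k e t) rotmx_block addn0. Qed.

Lemma rotmx_orth (R : realType) (k e : nat) (t : R) :
  rotmx k (2 * k + e) t *m (rotmx k (2 * k + e) t)^T = 1%:M.
Proof.
rewrite rotmx_block0 tr_block_mx mulmx_block !trmx0 trmx1 !mulmx0 !mul0mx.
by rewrite mulmx1 rotmx_orth_even !addr0 add0r -scalar_mx_block.
Qed.

Lemma KL_conj (R : realType) (n : nat) (l : 'I_n -> 'I_n -> \bar R) (t : R) :
  rotmx n (2 * n + 4) t *m KL l *m (rotmx n (2 * n + 4) t)^T = KL l.
Proof.
rewrite rotmx_block0 /KL tr_block_mx !mulmx_block !trmx0.
by rewrite !(mulmx0, mul0mx, addr0, add0r) rotmx_Lmx.
Qed.

(** Seen in the splitting 2m + 6 of the coordinates, the rotation is block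
diagonal with lower block [Pmx t], and the nodes before the last one meet only
zeros of Gamma. *)
Lemma Gammamx_conj (R : realType) (m : nat) (G0 : 'M[R]_6) (t : R) :
  Gammamx m G0 t =
  rotmx m.+1 (2 * m.+1 + 4) t *m Gammamx m G0 0
    *m (rotmx m.+1 (2 * m.+1 + 4) t)^T.
Proof.
have <- : castmx (coord_dimE m, coord_dimE m)
    (block_mx (rotmx m (2 * m) t) 0 0 (rotmx 1 6 t)) =
    rotmx m.+1 (2 * m.+1 + 4) t.
  by rewrite rotmx_block castmx_rotmx addn1.
rewrite /Gammamx castmx_conj; congr castmx.
rewrite tr_block_mx !mulmx_block !trmx0 !(mulmx0, mul0mx, addr0, add0r).
by rewrite !Pmx_rotmx oppr0 rotmx_at0 tr_rotmx mul1mx mulmx1.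
Qed.

Lemma Nmx_conj (R : realType) (m : nat) (l : 'I_m.+1 -> 'I_m.+1 -> \bar R)
    (G0 : 'M[R]_6) (t : R) :
  Nmx l G0 t =
  rotmx m.+1 (2 * m.+1 + 4) t *m Nmx l G0 0 *m (rotmx m.+1 (2 * m.+1 + 4) t)^T.
Proof. by rewrite /Nmx mulmxDr mulmxDl KL_conj -Gammamx_conj. Qed.

(** * The Schur-type expressions are rotated copies of their values at 0 *)

Lemma rot_entry_affine (R : realType) (k p q : nat) :
  trig_affine (fun t : R => rot_entry k t p q).
Proof.
rewrite /rot_entry; case: (_ != _); first by exists 0, 0, 0 => t; ring.
case: (_ < _)%N; last by exists (odd p == odd q)%:R, 0, 0 => t; ring.
case: (_ == _); first by exists 0, 0, 1 => t; ring.
by case: (odd p); [exists 0, 1, 0 | exists 0, (-1), 0] => t; ring.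
Qed.

(** A nonzero entry of the rotation links coordinates that are equal or belong
to the same node, and membership in [Lambda1] only depends on the node. *)
Lemma rotmx_Lambda1 (R : realType) (n : nat) (r : 'I_n -> \bar R) (t : R)
    (p q : 'I_(2 * n + 4)) :
  (p \in Lambda1 r) != (q \in Lambda1 r) -> rotmx n (2 * n + 4) t p q = 0.
Proof.
rewrite rotmx_block0 !inE.
case: (split_ordP p) => p' ->; case: (split_ordP q) => q' ->.
- rewrite block_mxEul mxE /rot_entry => nS; case: (p'./2 =P q'./2) => // hE.
  move: nS.
  have -> : node p' = node q' by apply: val_inj; exact: hE.
  by rewrite eqxx.
- by rewrite block_mxEur mxE.
- by rewrite block_mxEdl mxE.
- by rewrite eqxx.
Qed.

Lemma rotmx_Lambda_diag (R : realType) (n : nat) (r : 'I_n -> \bar R) (t : R) :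
  (forall p q, p \in Lambda1 r -> q \notin Lambda1 r ->
     rotmx n (2 * n + 4) t p q = 0) /\
  (forall p q, p \in Lambda2 r -> q \notin Lambda2 r ->
     rotmx n (2 * n + 4) t p q = 0).
Proof.
split=> p q; rewrite ?[_ \in Lambda2 r]in_setC ?negbK => pS qS;
  apply: (@rotmx_Lambda1 _ _ r).
- by rewrite pS (negPf qS).
- by rewrite (negPf pS) qS.
Qed.

Lemma A0mx_conj (R : realType) (m : nat) (l : 'I_m.+1 -> 'I_m.+1 -> \bar R)
    (r : 'I_m.+1 -> \bar R) (G0 : 'M[R]_6) (t : R) :
  let U := rotmx m.+1 (2 * m.+1 + 4) t in
  A0mx l r G0 t =
  submx_of (Lambda1 r) (Lambda1 r) U *m A0mx l r G0 0
    *m (submx_of (Lambda2 r) (Lambda2 r) U)^T.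
Proof.
move=> U.
have [U1 U2] := rotmx_Lambda_diag r t.
pose X1 := submx_of (Lambda1 r) (Lambda1 r) U.
have O1 : X1 *m X1^T = 1%:M := submx_of_orth U1 (rotmx_orth _ _ t).
rewrite /A0mx Nmx_conj -/U.
rewrite (submx_of_conj _ U1 U1) (submx_of_conj _ U1 U2) -/X1 invmx_conj //.
rewrite !mulNmx mulmxN mulNmx; congr (- _).
rewrite -!mulmxA; congr (_ *m (_ *m _)).
by rewrite [X1^T *m _]mulmxA (mulmx1C O1) mul1mx.
Qed.

(** With [D] the block diagonal matrix of [X1] and [X2], the renumbered N(t) is
[D N(0) D^T] and [A t = D *m A 0 *m X2^T]: the identity block of [A] is
reproduced because [X2 *m X2^T = 1].  In [A^T N A] both [D^T *m D] cancel. *)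
Lemma Ntilde_conj (R : realType) (m : nat) (l : 'I_m.+1 -> 'I_m.+1 -> \bar R)
    (r : 'I_m.+1 -> \bar R) (G0 : 'M[R]_6) (t : R) :
  let U := rotmx m.+1 (2 * m.+1 + 4) t in
  Ntilde l r G0 t =
  submx_of (Lambda2 r) (Lambda2 r) U *m Ntilde l r G0 0
    *m (submx_of (Lambda2 r) (Lambda2 r) U)^T.
Proof.
move=> U.
have [U1 U2] := rotmx_Lambda_diag r t.
pose X1 := submx_of (Lambda1 r) (Lambda1 r) U.
pose X2 := submx_of (Lambda2 r) (Lambda2 r) U.
have O1 : X1 *m X1^T = 1%:M := submx_of_orth U1 (rotmx_orth _ _ t).
have O2 : X2 *m X2^T = 1%:M := submx_of_orth U2 (rotmx_orth _ _ t).
rewrite -/X2.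
pose D := block_mx X1 0 0 X2.
have DtD : D^T *m D = 1%:M.
  rewrite tr_block_mx mulmx_block !trmx0 !(mulmx0, mul0mx, addr0, add0r).
  by rewrite (mulmx1C O1) (mulmx1C O2) -scalar_mx_block.
have AE : Amx l r G0 t = D *m Amx l r G0 0 *m X2^T.
  rewrite /Amx mul_block_col !mul0mx addr0 add0r mulmx1 mul_col_mx.
  by rewrite O2 A0mx_conj.
have NE : renumber (Lambda1 r) (Lambda2 r) (Nmx l G0 t) =
    D *m renumber (Lambda1 r) (Lambda2 r) (Nmx l G0 0) *m D^T.
  rewrite tr_block_mx !mulmx_block !trmx0 !(mulmx0, mul0mx, addr0, add0r).
  rewrite /renumber Nmx_conj -/U (submx_of_conj _ U1 U1).
  by rewrite (submx_of_conj _ U1 U2) (submx_of_conj _ U2 U1)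
    (submx_of_conj _ U2 U2).
rewrite /Ntilde AE NE !trmx_mul trmxK -!mulmxA.
by do 2![rewrite [D^T *m (D *m _)]mulmxA DtD mul1mx].
Qed.

Theorem lemma2p4 (R : realType) (m : nat)
    (l : 'I_m.+1 -> 'I_m.+1 -> \bar R) (r : 'I_m.+1 -> \bar R)
    (G0 : 'M[R]_6)
    (l_sym : forall i j : 'I_m.+1, i != j -> l i j = l j i)
    (l_gt0 : forall i j : 'I_m.+1, i != j -> (0 < l i j)%E)
    (l_conn : line_connected l)
    (r_gt0 : forall i : 'I_m.+1, (0 < r i)%E)
    (r1_fin : (r ord0 < +oo)%E)
    (G0_posdef : posdefmx G0) :
  (forall (i : 'I_#|Lambda1 r|) (j : 'I_#|Lambda2 r|),
      trig_lincomb (fun t : R => A0mx l r G0 t i j)) /\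
  (forall i j : 'I_#|Lambda2 r|,
      trig_lincomb (fun t : R => Ntilde l r G0 t i j)).
Proof.
have aff S T i j : trig_affine (fun t : R =>
    submx_of S T (rotmx m.+1 (2 * m.+1 + 4) t) i j).
  have [a [b [c H]]] := rot_entry_affine R m.+1 (enum_val i) (enum_val j).
  by exists a, b, c => t; rewrite !mxE.
split.
- exact: trig_lincomb_conj (aff _ _) (aff _ _) (A0mx_conj l r G0).
- exact: trig_lincomb_conj (aff _ _) (aff _ _) (Ntilde_conj l r G0).
Qed.
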